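(* Let $K$ be a field of characteristic zero and $R$ a commutative $K$-algebra. Suppose that $D_{R|K}$ is generated as a ring by $D^1_{R|K}$. Then $\mathrm{BS}^R_f(s)=\mathrm{SBS}^R_f(s)$ for every nonzerodivisor $f\in R$. In particular, for $R=K[x_1,\dots,x_n]$, Bernstein-Sato polynomials and sandwich Bernstein-Sato polynomials of nonzero elements coincide.
   Context: Differential operators: for a commutative $K$-algebra $R$, $D_{R|K}\subseteq \operatorname{End}_K(R)$ is the ring of $K$-linear differential operators: $D^0_{R|K}$ is the set of multiplication operators by elements of $R$ (identified with $R$), $D^{n+1}_{R|K}=\{\delta\in\operatorname{End}_K(R): [\delta,r]\in D^n_{R|K}\text{ for all } r\in R\}$, and $D_{R|K}=\bigcup_n D^n_{R|K}$, with composition as product. Differential operators on $R$ extend uniquely to differential operators on $R_f$. Sandwich Bernstein-Sato polynomial: a sandwich Bernstein-Sato equation for $f\in R$ consists of finitely many $\alpha_i(s),\beta_i(s)\in D_{R|K}[s]$ and $b(s)\in K[s]$ with $\sum_i \alpha_i(n) f^{n+1}\beta_i(n)=b(n)f^n$ as operators in $D_{R|K}$ (products are compositions) for all $n\in\mathbb{N}=\{0,1,2,\dots\}$. The set of $b(s)$ occurring is an ideal of $K[s]$; $\mathrm{SBS}^R_f(s)$ is its monic generator, or $0$ if the ideal is zero. Bernstein-Sato polynomial: a Bernstein-Sato functional equation for $f$ consists of $\delta(s)\in D_{R|K}[s]$ and $b(s)\in K[s]$ such that $\delta(n)(f^{n+1})=b(n)f^n$ in $R_f$ for all $n\in\mathbb{Z}$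 (action of operators on elements). $\mathrm{BS}^R_f(s)$ is the monic generator of the ideal of all $b(s)$ occurring in such equations, or $0$ if that ideal is zero. *)

(* Defs.v *)
From HB Require Import structures.
From mathcomp Require Import all_boot all_order all_algebra.
From mathcomp Require Import boolp classical_sets.
From mathcomp Require Import ring.

Set Implicit Arguments.
Unset Strict Implicit.
Unset Printing Implicit Defensive.

Import GRing.Theory.
Local Open Scope ring_scope.
Local Open Scope quotient_scope.
Local Open Scope classical_set_scope.

(* End_K(R); its product is composition. *)
Section Endomorphisms.
Context (K : fieldType) (R : comAlgType K).

Definition endo : Type := {linear R -> R}.

HB.instance Definition _ := gen_eqMixin endo.
HB.instance Definition _ := gen_choiceMixin endo.

Implicit Types d e : endo.

Lemma endoP d e : (forall x, d x = e x) -> d = e.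
Proof.
case: d e => [d [[dm] [dl]]] [e [[em] [el]]] /= /funext ed.
move: dm dl em el; rewrite {}ed => dm dl em el.
by rewrite (Prop_irrelevance dm em) (Prop_irrelevance dl el).
Qed.

Fact endo_add_linear d e : linear (fun x => d x + e x).
Proof. by move=> a x y; rewrite !linearP scalerDr addrACA. Qed.
Fact endo_opp_linear d : linear (fun x => - d x).
Proof. by move=> a x y; rewrite linearP opprD scalerN. Qed.
Fact endo_zero_linear : linear (fun _ : R => 0 : R).
Proof. by move=> a x y; rewrite scaler0 addr0. Qed.
Fact endo_mul_linear d e : linear (fun x => d (e x)).
Proof. by move=> a x y; rewrite !linearP. Qed.
Fact endo_one_linear : linear (fun x : R => x).
Proof. by []. Qed.

Definition endo_of (h : R -> R) (hl : linear h) : endo :=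
  HB.pack h (GRing.isLinear.Build K R R *:%R h hl).

Let add d e := endo_of (endo_add_linear d e).
Let opp d := endo_of (endo_opp_linear d).
Let zero := endo_of endo_zero_linear.
Let mul d e := endo_of (endo_mul_linear d e).
Let one := endo_of endo_one_linear.

Let addA : associative add.
Proof. by move=> *; apply: endoP => x /=; rewrite addrA. Qed.
Let addC : commutative add.
Proof. by move=> *; apply: endoP => x /=; rewrite addrC. Qed.
Let add0 : left_id zero add.
Proof. by move=> *; apply: endoP => x /=; rewrite add0r. Qed.
Let addN : left_inverse zero opp add.
Proof. by move=> *; apply: endoP => x /=; rewrite addNr. Qed.

HB.instance Definition _ := GRing.isZmodule.Build endo addA addC add0 addN.

Let mulA : associative mul.
Proof. by move=> *; apply: endoP. Qed.
Let mul1 : left_id one mul.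
Proof. by move=> *; apply: endoP. Qed.
Let mulr1 : right_id one mul.
Proof. by move=> *; apply: endoP. Qed.
Let mulDl : left_distributive mul add.
Proof. by move=> *; apply: endoP. Qed.
Let mulDr : right_distributive mul add.
Proof. by move=> *; apply: endoP => x /=; rewrite linearD. Qed.
Let one_neq0 : one != 0.
Proof.
by apply/eqP => /(congr1 (fun d : endo => d 1)) /= /eqP; rewrite oner_eq0.
Qed.

HB.instance Definition _ :=
  GRing.Zmodule_isNzRing.Build endo mulA mul1 mulr1 mulDl mulDr one_neq0.

Lemma endo0E x : (0 : endo) x = 0. Proof. by []. Qed.
Lemma endo1E x : (1 : endo) x = x. Proof. by []. Qed.
Lemma endoDE d e x : (d + e) x = d x + e x. Proof. by []. Qed.
Lemma endoNE d x : (- d) x = - d x. Proof. by []. Qed.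
Lemma endoME d e x : (d * e) x = d (e x). Proof. by []. Qed.

Fact mulop_linear (r : R) : linear (fun x => r * x).
Proof. by move=> a x y; rewrite mulrDr scalerAr. Qed.

Definition mulop (r : R) : endo := endo_of (mulop_linear r).

Lemma mulopE r x : mulop r x = r * x. Proof. by []. Qed.

End Endomorphisms.

Section DifferentialOperators.
Context (K : fieldType) (R : comAlgType K).

Fixpoint diffops_le (n : nat) : set (endo R) :=
  if n is m.+1 then
    [set d | forall r : R, diffops_le m (d * mulop r - mulop r * d)]
  else range (@mulop K R).

Definition diffops : set (endo R) := \bigcup_n diffops_le n.

Definition generated_as_ring_by (D G : set (endo R)) : Prop :=
  D = smallest (fun A => GRing.subring_closed [in A]) G.

End DifferentialOperators.
Arguments diffops_le {K} R n.
Arguments diffops {K} R.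

Section DifferentialOperatorsTheory.
Context (K : fieldType) (R : comAlgType K).
Implicit Types (a b r : R) (d e : endo R).

Lemma mulopM a b : mulop (a * b) = mulop a * mulop b.
Proof. by apply: endoP => x; rewrite endoME !mulopE mulrA. Qed.

Lemma diffops_leB n d e :
  diffops_le R n d -> diffops_le R n e -> diffops_le R n (d - e).
Proof.
elim: n d e => [|n IHn] d e /=.
  move=> [a _ <-] [b _ <-]; exists (a - b) => //; apply: endoP => x.
  by rewrite endoDE endoNE !mulopE mulrBl.
move=> Dd De r; have := IHn _ _ (Dd r) (De r).
by rewrite mulrBl mulrBr !opprB [mulop r * e - _]addrC addrACA [- _ + _]addrC.
Qed.

Lemma diffops_leN n d : diffops_le R n d -> diffops_le R n (- d).
Proof.
by move=> Dd; have := diffops_leB (diffops_leB Dd Dd) Dd; rewrite subrr sub0r.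
Qed.

Lemma diffops_leD n d e :
  diffops_le R n d -> diffops_le R n e -> diffops_le R n (d + e).
Proof. by move=> Dd /diffops_leN De; rewrite -[e]opprK; apply: diffops_leB. Qed.

Lemma diffops_le_mulopl n a d :
  diffops_le R n d -> diffops_le R n (mulop a * d).
Proof.
elim: n d => [|n IHn] d /=; first by move=> [b _ <-]; exists (a * b);
    rewrite ?mulopM.
move=> Dd r; suff -> : mulop a * d * mulop r - mulop r * (mulop a * d) =
  mulop a * (d * mulop r - mulop r * d) by exact: IHn.
by rewrite mulrBr !mulrA -!mulopM [r * a]mulrC.
Qed.

Lemma diffops_le_mulopr n a d :
  diffops_le R n d -> diffops_le R n (d * mulop a).
Proof.
elim: n d => [|n IHn] d /=; first by move=> [b _ <-]; exists (b * a);
    rewrite ?mulopM.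
move=> Dd r; suff -> : d * mulop a * mulop r - mulop r * (d * mulop a) =
  (d * mulop r - mulop r * d) * mulop a by exact: IHn.
by rewrite mulrBl -!mulrA -!mulopM [r * a]mulrC.
Qed.

Lemma diffops_leS m n d : (m <= n)%N -> diffops_le R m d -> diffops_le R n d.
Proof.
elim: n m d => [|n IHn] [|m] d //.
  move=> _ [a _ <-] r; apply: (IHn 0) => //; exists 0 => //.
  rewrite -!mulopM [r * a]mulrC subrr.
  by apply: endoP => x; rewrite mulopE mul0r.
by move=> mn Dd r; apply: (IHn m).
Qed.

End DifferentialOperatorsTheory.

(* R_f for a nonzerodivisor f: the pair (a, m) stands for a / f ^+ m. *)
Section Localization.
Context (K : fieldType) (R : comAlgType K) (f : R) (reg_f : GRing.lreg f).

Let regX n : GRing.lreg (f ^+ n). Proof. exact: lregX. Qed.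

Definition loc_rel (u v : R * nat) := f ^+ v.2 * u.1 == f ^+ u.2 * v.1.

Fact loc_rel_refl : reflexive loc_rel. Proof. by move=> u; apply: eqxx. Qed.
Fact loc_rel_sym : symmetric loc_rel.
Proof. by move=> u v; rewrite /loc_rel eq_sym. Qed.
Fact loc_rel_trans : transitive loc_rel.
Proof.
move=> [b n] [a m] [c p] /eqP /= ab /eqP /= bc; apply/eqP => /=.
by apply: (regX (n := n)); rewrite mulrCA ab mulrCA bc mulrCA.
Qed.

Canonical loc_equiv :=
  EquivRel loc_rel loc_rel_refl loc_rel_sym loc_rel_trans.

Definition loc : Type := {eq_quot loc_equiv}.

HB.instance Definition _ := Choice.on loc.
HB.instance Definition _ := EqQuotient.on loc.

Definition lfrac (a : R) (m : nat) : loc := \pi_loc (a, m).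

Lemma eq_lfrac a m b n :
  (lfrac a m == lfrac b n) = (f ^+ n * a == f ^+ m * b).
Proof. by rewrite /lfrac piE. Qed.

Lemma lfracP (x : loc) : exists a m, x = lfrac a m.
Proof. by elim/quotW: x => -[a m]; exists a, m. Qed.

Let add (x y : loc) : loc :=
  let: (a, m) := repr x in let: (b, n) := repr y in
  lfrac (f ^+ n * a + f ^+ m * b) (m + n).
Let opp (x : loc) : loc := let: (a, m) := repr x in lfrac (- a) m.
Let mul (x y : loc) : loc :=
  let: (a, m) := repr x in let: (b, n) := repr y in lfrac (a * b) (m + n).
Let scale (c : K) (x : loc) : loc := let: (a, m) := repr x in lfrac (c *: a) m.

Let repr_lfrac a m :
  f ^+ m * (repr (lfrac a m)).1 = f ^+ (repr (lfrac a m)).2 * a.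
Proof.
apply/eqP; rewrite -/(loc_rel (repr (lfrac a m)) (a, m)).
by rewrite -[loc_rel _ _]/(loc_equiv _ _) -eqmodE reprK.
Qed.

Let addE a m b n :
  add (lfrac a m) (lfrac b n) = lfrac (f ^+ n * a + f ^+ m * b) (m + n).
Proof.
rewrite /add; move: (repr_lfrac a m) (repr_lfrac b n).
case: (repr _) => a' m'; case: (repr _) => b' n' /= ea eb.
apply/eqP; rewrite eq_lfrac !mulrDr !exprD; apply/eqP; congr (_ + _).
  transitivity (f ^+ n * f ^+ n' * (f ^+ m * a')); first by ring.
  by rewrite ea; ring.
transitivity (f ^+ m * f ^+ m' * (f ^+ n * b')); first by ring.
by rewrite eb; ring.
Qed.

Let oppE a m : opp (lfrac a m) = lfrac (- a) m.
Proof.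
rewrite /opp; move: (repr_lfrac a m); case: (repr _) => a' m' /= ea.
by apply/eqP; rewrite eq_lfrac !mulrN ea.
Qed.

Let mulE a m b n : mul (lfrac a m) (lfrac b n) = lfrac (a * b) (m + n).
Proof.
rewrite /mul; move: (repr_lfrac a m) (repr_lfrac b n).
case: (repr _) => a' m'; case: (repr _) => b' n' /= ea eb.
by apply/eqP; rewrite eq_lfrac !exprD mulrACA ea eb mulrACA.
Qed.

Let scaleE c a m : scale c (lfrac a m) = lfrac (c *: a) m.
Proof.
rewrite /scale; move: (repr_lfrac a m); case: (repr _) => a' m' /= ea.
by apply/eqP; rewrite eq_lfrac -!scalerAr ea.
Qed.

Let addA : associative add.
Proof.
move=> x y z; have [a [m ->]] := lfracP x; have [b [n ->]] := lfracP y.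
have [c [p ->]] := lfracP z; rewrite !addE addnA; congr lfrac.
by rewrite !exprD; ring.
Qed.
Let addC : commutative add.
Proof.
move=> x y; have [a [m ->]] := lfracP x; have [b [n ->]] := lfracP y.
by rewrite !addE addnC addrC.
Qed.
Let add0 : left_id (lfrac 0 0) add.
Proof.
move=> x; have [a [m ->]] := lfracP x.
by rewrite addE mulr0 add0r expr0 mul1r.
Qed.
Let addN : left_inverse (lfrac 0 0) opp add.
Proof.
move=> x; have [a [m ->]] := lfracP x; rewrite oppE addE mulrN addNr.
by apply/eqP; rewrite eq_lfrac !mulr0.
Qed.

HB.instance Definition _ := GRing.isZmodule.Build loc addA addC add0 addN.

Let mulA : associative mul.
Proof.
move=> x y z; have [a [m ->]] := lfracP x; have [b [n ->]] := lfracP y.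
by have [c [p ->]] := lfracP z; rewrite !mulE mulrA addnA.
Qed.
Let mulC : commutative mul.
Proof.
move=> x y; have [a [m ->]] := lfracP x; have [b [n ->]] := lfracP y.
by rewrite !mulE addnC mulrC.
Qed.
Let mul1 : left_id (lfrac 1 0) mul.
Proof. by move=> x; have [a [m ->]] := lfracP x; rewrite mulE mul1r. Qed.
Let mulDl : left_distributive mul add.
Proof.
move=> x y z; have [a [m ->]] := lfracP x; have [b [n ->]] := lfracP y.
have [c [p ->]] := lfracP z; rewrite addE !mulE addE.
by apply/eqP; rewrite eq_lfrac !exprD; apply/eqP; ring.
Qed.
Let one_neq0 : lfrac 1 0 != 0.
Proof. by rewrite eq_lfrac !expr0 !mul1r oner_eq0. Qed.

HB.instance Definition _ :=
  GRing.Zmodule_isComNzRing.Build loc mulA mulC mul1 mulDl one_neq0.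

Let scaleA c d x : scale c (scale d x) = scale (c * d) x.
Proof. by have [a [m ->]] := lfracP x; rewrite !scaleE scalerA. Qed.
Let scale1 : left_id 1 scale.
Proof. by move=> x; have [a [m ->]] := lfracP x; rewrite scaleE scale1r. Qed.
Let scaleDr : right_distributive scale +%R.
Proof.
move=> c x y; have [a [m ->]] := lfracP x; have [b [n ->]] := lfracP y.
by rewrite [lfrac a m + _]addE !scaleE [RHS]addE scalerDr -!scalerAr.
Qed.
Let scaleDl x : {morph scale^~ x : c d / c + d}.
Proof.
move=> c d; have [a [m ->]] := lfracP x; rewrite !scaleE [RHS]addE.
by apply/eqP; rewrite eq_lfrac -mulrDr -scalerDl exprD mulrA.
Qed.

HB.instance Definition _ :=
  GRing.Zmodule_isLmodule.Build K loc scaleA scale1 scaleDr scaleDl.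

Let scaleAl c (x y : loc) : c *: (x * y) = c *: x * y.
Proof.
have [a [m ->]] := lfracP x; have [b [n ->]] := lfracP y.
transitivity (scale c (mul (lfrac a m) (lfrac b n))); first by [].
by rewrite mulE scaleE scalerAl -mulE -scaleE.
Qed.

HB.instance Definition _ := GRing.Lmodule_isLalgebra.Build K loc scaleAl.
HB.instance Definition _ := GRing.Lalgebra_isComAlgebra.Build K loc.

Lemma lfracD a m b n :
  lfrac a m + lfrac b n = lfrac (f ^+ n * a + f ^+ m * b) (m + n).
Proof. exact: addE. Qed.
Lemma lfracN a m : - lfrac a m = lfrac (- a) m. Proof. exact: oppE. Qed.
Lemma lfracM a m b n : lfrac a m * lfrac b n = lfrac (a * b) (m + n).
Proof. exact: mulE. Qed.
Lemma lfracZ c a m : c *: lfrac a m = lfrac (c *: a) m.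
Proof. exact: scaleE. Qed.
Lemma lfrac0 : lfrac 0 0 = 0. Proof. by []. Qed.
Lemma lfrac1 : lfrac 1 0 = 1. Proof. by []. Qed.

(* The power f ^ k in R_f, for an integer k. *)
Definition loc_exp (k : int) : loc :=
  match k with Posz m => lfrac (f ^+ m) 0 | Negz m => lfrac 1 m.+1 end.

Definition extends (d : endo R) (e : endo loc) : Prop :=
  forall a, e (lfrac a 0) = lfrac (d a) 0.

Implicit Types (a b r : R) (d : endo R) (e : endo loc).

Lemma lfracE a m : lfrac a m = lfrac a 0 * lfrac 1 m.
Proof. by rewrite lfracM mulr1 add0n. Qed.

Lemma lfrac0M a b : lfrac (a * b) 0 = lfrac a 0 * lfrac b 0.
Proof. by rewrite lfracM. Qed.
Lemma lfrac0B a b : lfrac (a - b) 0 = lfrac a 0 - lfrac b 0.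
Proof. by rewrite lfracN lfracD !expr0 !mul1r. Qed.
Lemma lfrac0D a b : lfrac (a + b) 0 = lfrac a 0 + lfrac b 0.
Proof. by rewrite lfracD !expr0 !mul1r. Qed.

Lemma lfracK m : lfrac (f ^+ m) 0 * lfrac 1 m = 1.
Proof.
rewrite lfracM -lfrac1 add0n mulr1; apply/eqP.
by rewrite eq_lfrac !expr0 mul1r mulr1.
Qed.

Lemma lfracI m (x y : loc) :
  lfrac (f ^+ m) 0 * x = lfrac (f ^+ m) 0 * y -> x = y.
Proof.
move=> /(congr1 (fun z => lfrac 1 m * z)).
by rewrite !mulrA [lfrac 1 m * _]mulrC lfracK !mul1r.
Qed.

Lemma lfrac_den a m : lfrac (f ^+ m) 0 * lfrac a m = lfrac a 0.
Proof. by rewrite (lfracE a) mulrCA lfracK mulr1. Qed.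

Lemma ext0 n e : diffops_le loc n e -> extends 0 e -> e = 0.
Proof.
elim: n e => [|n IHn] e /=.
  move=> [c _ <-] /(_ 1); rewrite mulopE lfrac1 mulr1 endo0E lfrac0 => ->.
  by apply: endoP => x; rewrite mulopE mul0r.
move=> De e0; apply: endoP => x; have [a [m ->]] := lfracP x.
rewrite endo0E; apply: (@lfracI m); rewrite mulr0.
have /(congr1 (fun h : endo loc => h (lfrac a m))) :
    e * mulop (lfrac (f ^+ m) 0) - mulop (lfrac (f ^+ m) 0) * e = 0.
  apply: IHn => [|b]; first exact: De.
  rewrite endoDE endoNE !endoME !mulopE -lfrac0M !e0 !endo0E lfrac0.
  by rewrite mulr0 subrr.
rewrite endoDE endoNE !endoME !mulopE lfrac_den e0 !endo0E lfrac0 sub0r.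
by move/eqP; rewrite oppr_eq0 => /eqP.
Qed.

Lemma ext_uniq n d e e' : diffops_le loc n e -> diffops_le loc n e' ->
  extends d e -> extends d e' -> e = e'.
Proof.
move=> De De' de de'; apply/eqP; rewrite -subr_eq0; apply/eqP.
apply: (@ext0 n); first exact: diffops_leB.
by move=> a; rewrite endoDE endoNE de de' endo0E subrr.
Qed.

Lemma ext_ex n d : diffops_le R n d ->
  exists2 e, diffops_le loc n e & extends d e.
Proof.
elim: n d => [|n IHn] d.
  move=> [a _ <-]; exists (mulop (lfrac a 0)); first by exists (lfrac a 0).
  by move=> b; rewrite !mulopE lfrac0M.
move=> Dd; have /choice[E EP] : forall r, exists e, diffops_le loc n e /\
    extends (d * mulop r - mulop r * d) e.
  by move=> r; have [e] := IHn _ (Dd r); exists e.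
have EM r s : E (r * s) = E r * mulop (lfrac s 0) + mulop (lfrac r 0) * E s.
  apply: (@ext_uniq n (d * mulop (r * s) - mulop (r * s) * d)).
  - by case: (EP (r * s)).
  - by apply: diffops_leD; [apply: diffops_le_mulopr|apply: diffops_le_mulopl];
      case: (EP r); case: (EP s).
  - by case: (EP (r * s)).
  move=> a; have [_ Er] := EP r; have [_ Es] := EP s.
  rewrite endoDE !endoME !mulopE -lfrac0M Er Es -lfrac0M -lfrac0D.
  rewrite !endoDE !endoNE !endoME !mulopE; congr lfrac.
  by rewrite mulrBr addrA subrK !mulrA.
pose h (x : loc) := let: (a, m) := repr x in
  (lfrac (d a) 0 - E (f ^+ m) x) * lfrac 1 m.
have key a m n' : lfrac (f ^+ n') 0 * (lfrac (d a) 0 - E (f ^+ m) (lfrac a m)) =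
    lfrac (d (f ^+ n' * a)) 0 - E (f ^+ n' * f ^+ m) (lfrac a m).
  rewrite EM endoDE !endoME !mulopE lfrac_den; have [_ ->] := EP (f ^+ n').
  by rewrite !endoDE !endoNE !endoME !mulopE lfrac0B lfrac0M; ring.
have hE a m :
    h (lfrac a m) = (lfrac (d a) 0 - E (f ^+ m) (lfrac a m)) * lfrac 1 m.
  rewrite /h; move: (reprK (lfrac a m)); case: (repr _) => b p.
  rewrite -[\pi_ _ _]/(lfrac b p) => eb.
  apply: (@lfracI m); apply: (@lfracI p).
  transitivity (lfrac (f ^+ p) 0 * lfrac 1 p *
      (lfrac (f ^+ m) 0 * (lfrac (d b) 0 - E (f ^+ p) (lfrac a m))));
    first by ring.
  transitivity (lfrac (f ^+ m) 0 * lfrac 1 m *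
      (lfrac (f ^+ p) 0 * (lfrac (d a) 0 - E (f ^+ m) (lfrac a m))));
    last by ring.
  rewrite !lfracK !mul1r key -{1}eb key [f ^+ p * f ^+ m]mulrC eb.
  by move/eqP: eb; rewrite eq_lfrac => /eqP ->.
have hl : linear h.
  move=> c x y; have [a [m ->]] := lfracP x; have [b [p ->]] := lfracP y.
  have -> : lfrac a m = lfrac (f ^+ p * a) (m + p).
    by apply/eqP; rewrite eq_lfrac exprD; apply/eqP; ring.
  have -> : lfrac b p = lfrac (f ^+ m * b) (m + p).
    by apply/eqP; rewrite eq_lfrac exprD; apply/eqP; ring.
  move: (f ^+ p * a) (f ^+ m * b) (m + p)%N => {}a {}b {}m.
  have fracL u v : c *: lfrac u m + lfrac v m = lfrac (c *: u + v) m.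
    rewrite lfracZ lfracD; apply/eqP; rewrite eq_lfrac exprD; apply/eqP.
    by rewrite !mulrDr; congr (_ + _); ring.
  rewrite fracL !hE -fracL (linearP d) (linearP (E (f ^+ m))).
  rewrite scalerAl -mulrDl; congr (_ * _).
  have -> : lfrac (c *: d a + d b) 0 = c *: lfrac (d a) 0 + lfrac (d b) 0.
    by rewrite lfrac0D lfracZ.
  by rewrite scalerBr opprD addrACA.
pose e : endo loc := endo_of hl.
have eE a m : lfrac (f ^+ m) 0 * e (lfrac a m) =
    lfrac (d a) 0 - E (f ^+ m) (lfrac a m).
  by rewrite [e _]hE mulrCA lfracK mulr1.
exists e => [|a]; last first.
  have := eE a 0; rewrite expr0 lfrac1 mul1r => ->; have [_ ->] := EP 1.
  by rewrite endoDE endoNE !endoME !mulopE !mul1r subrr lfrac0 subr0.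
have eR r : e * mulop (lfrac r 0) - mulop (lfrac r 0) * e = E r.
  apply: endoP => x; have [a [m ->]] := lfracP x; apply: (@lfracI m).
  have EC : E (f ^+ m) * mulop (lfrac r 0) - mulop (lfrac r 0) * E (f ^+ m) =
            E r * mulop (lfrac (f ^+ m) 0) - mulop (lfrac (f ^+ m) 0) * E r.
    have H := EM (f ^+ m) r; rewrite mulrC EM in H.
    by apply/eqP; rewrite subr_eq addrAC H addrK.
  have := congr1 (fun g : endo loc => g (lfrac a m)) EC.
  rewrite !endoDE !endoNE !endoME !mulopE lfrac_den => EC'.
  have rx : lfrac r 0 * lfrac a m = lfrac (r * a) m by rewrite lfracM.
  have Era : E r (lfrac a 0) = lfrac (d (r * a)) 0 - lfrac r 0 * lfrac (d a) 0.
    have [_ ->] := EP r.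
    by rewrite endoDE endoNE !endoME !mulopE lfrac0B lfrac0M.
  have -> : lfrac (f ^+ m) 0 * E r (lfrac a m) = E r (lfrac a 0) -
      (E (f ^+ m) (lfrac r 0 * lfrac a m) - lfrac r 0 * E (f ^+ m) (lfrac a m)).
    by rewrite EC'; ring.
  rewrite mulrBr mulrCA eE rx eE Era; ring.
move=> y; have [r [l ->]] := lfracP y.
have -> : e * mulop (lfrac r l) - mulop (lfrac r l) * e =
    E r * mulop (lfrac 1 l)
    - mulop (lfrac r l) * (E (f ^+ l) * mulop (lfrac 1 l)).
  rewrite -!eR (lfracE r) !mulopM !mulrBl !mulrBr !mulrA.
  rewrite -!mulrA -[mulop (lfrac (f ^+ l) 0) * mulop (lfrac 1 l)]mulopM lfracK.
  rewrite [mulop (lfrac 1 l) * (mulop (lfrac (f ^+ l) 0) * _)]mulrA.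
  rewrite -[mulop (lfrac 1 l) * mulop (lfrac (f ^+ l) 0)]mulopM.
  rewrite [lfrac 1 l * _]mulrC lfracK.
  have -> : mulop 1 = 1 :> endo loc by apply: endoP => x; rewrite mulopE mul1r.
  by rewrite mulr1 mul1r opprB addrA subrK.
apply: diffops_leB; first by apply: diffops_le_mulopr; case: (EP r).
by apply: diffops_le_mulopl; apply: diffops_le_mulopr; case: (EP (f ^+ l)).
Qed.

(* The value for a differential operator d is its unique extension to R_f,
   by loc_extP and loc_ext_uniq. *)
Definition loc_ext (d : endo R) : endo loc :=
  xget 0 [set e | diffops loc e /\ extends d e].

Lemma loc_extP d : diffops R d ->
  diffops loc (loc_ext d) /\ extends d (loc_ext d).
Proof.
move=> [n _ /ext_ex [e De de]].
apply: (@xgetPex _ 0 [set e | diffops loc e /\ extends d e]).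
by exists e; split=> //; exists n.
Qed.

Lemma loc_ext_uniq d e : diffops R d -> diffops loc e -> extends d e ->
  loc_ext d = e.
Proof.
move=> /loc_extP [[m _ Dm] dm] [n _ De] de.
apply: (@ext_uniq (maxn m n) d) => //.
  by apply: diffops_leS Dm; apply: leq_maxl.
by apply: diffops_leS De; apply: leq_maxr.
Qed.

End Localization.

Section BernsteinSato.
Context (K : fieldType) (R : comAlgType K).

(* The monic generator of the ideal I of K[s], or 0 if I is zero: no monic
   polynomial generates the zero ideal. *)
Definition monic_generator (I : set {poly K}) : {poly K} :=
  xget 0 [set p | p \is monic /\ I = [set q | p %| q]].

Definition SBS_equation (f : R) (ops : seq ({poly endo R} * {poly endo R}))
    (b : {poly K}) : Prop :=
  forall n : nat,
    \sum_(ab <- ops) ab.1.[n%:R] * mulop (f ^+ n.+1) * ab.2.[n%:R]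
    = mulop (b.[n%:R] *: f ^+ n).

Definition SBS_ideal (f : R) : set {poly K} :=
  [set b | exists2 ops : seq ({poly endo R} * {poly endo R}),
     (forall ab, ab \in ops -> ab.1 \is a polyOver [in diffops R] /\
                               ab.2 \is a polyOver [in diffops R])
     & SBS_equation f ops b].

Definition SBS (f : R) : {poly K} := monic_generator (SBS_ideal f).

Definition BS_equation (f : R) (reg_f : GRing.lreg f) (d : {poly endo R})
    (b : {poly K}) : Prop :=
  forall n : int,
    loc_ext reg_f d.[n%:~R] (loc_exp reg_f (n + 1))
    = b.[n%:~R] *: loc_exp reg_f n.

Definition BS_ideal (f : R) (reg_f : GRing.lreg f) : set {poly K} :=
  [set b | exists2 d : {poly endo R},
     d \is a polyOver [in diffops R] & BS_equation reg_f d b].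

Definition BS (f : R) (reg_f : GRing.lreg f) : {poly K} :=
  monic_generator (BS_ideal reg_f).

End BernsteinSato.

(* Main.v *)
(* Evaluating a sandwich equation at 1 gives
   sum_i alpha_i(n) (beta_i(n)(1) f^(n+1)) = b(n) f^n for n >= 0, and hence for
   all integers n, since n |-> f^-n d(f^n) is a polynomial function of n (its
   iterated differences come from iterated commutators of d with f).
   Conversely, the operators d for which multiplication by d(g) has the form
   sum_i a_i g b_i, with differential operators a_i and b_i not depending on g,
   form a ring, which contains multiplications, and derivations t because
   t(g) = [t, g]; so it contains D if D^1 generates D. For polynomials in
   characteristic 0, an operator of order <= k agrees on the monomials of degree
   <= k with a combination of the partial derivatives of order <= k, and an
   operator of order <= k that kills these monomials is 0. *)

Require Import Defs.
From HB Require Import structures.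
From mathcomp Require Import all_boot all_order all_algebra.
From mathcomp Require Import boolp classical_sets ring.

Set Implicit Arguments.
Unset Strict Implicit.
Unset Printing Implicit Defensive.

Import GRing.Theory.
Local Open Scope ring_scope.
Local Open Scope classical_set_scope.

(** * Differential operators as a ring filtered by order *)

Section DiffopsSubring.
Context (K : fieldType) (R : comAlgType K).
Implicit Types (r : R) (d e : endo R).

Lemma mulop1 : mulop 1 = 1 :> endo R.
Proof. by apply: endoP => x; rewrite mulopE mul1r. Qed.

(** Induction on [m + n]: the Leibniz rule [[d * e, r] = d * [e, r] + [d, r] * e] leaves two
    products whose total order is one less. *)
Lemma diffops_leM m n d e :
  diffops_le R m d -> diffops_le R n e -> diffops_le R (m + n) (d * e).
Proof.
move eqN: (m + n)%N => N; elim: N m n eqN d e => [|N IHN] [|m] [|n] //.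
- by move=> _ d e [a _ <-]; apply: diffops_le_mulopl.
- by rewrite add0n => -> d e [a _ <-]; apply: diffops_le_mulopl.
- by rewrite addn0 => -> d e De [a _ <-]; apply: diffops_le_mulopr.
rewrite addSn => -[eqN] d e Dd De r.
have -> : d * e * mulop r - mulop r * (d * e) =
    d * (e * mulop r - mulop r * e) + (d * mulop r - mulop r * d) * e.
  by rewrite mulrBr mulrBl !mulrA addrA subrK.
apply: diffops_leD; first by apply: (IHN m.+1 n) => //; rewrite addSnnS.
exact: (IHN m n.+1).
Qed.

Lemma diffopsP d : reflect (exists n, diffops_le R n d) (d \in diffops R).
Proof.
apply: (iffP idP) => [/set_mem[n _ Dd]|[n Dd]]; first by exists n.
by apply/mem_set; exists n.
Qed.

Lemma mulop_diffops r : mulop r \in diffops R.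
Proof. by apply/diffopsP; exists 0%N; exists r. Qed.

Lemma diffops_subring_closed : GRing.subring_closed [in diffops R].
Proof.
split=> [|d e|d e].
- by rewrite -mulop1 mulop_diffops.
- move=> /diffopsP[m Dd] /diffopsP[n De]; apply/diffopsP.
  exists (maxn m n); apply: diffops_leB.
    by apply: diffops_leS Dd; apply: leq_maxl.
  by apply: diffops_leS De; apply: leq_maxr.
- move=> /diffopsP[m Dd] /diffopsP[n De].
  by apply/diffopsP; exists (m + n)%N; apply: diffops_leM.
Qed.

(* A named copy of [in diffops R], on which the subring structure can be
   declared. *)
Definition diffop_pred : {pred endo R} := [in diffops R].

HB.instance Definition _ :=
  GRing.isSubringClosed.Build (endo R) diffop_pred diffops_subring_closed.

Lemma mulop_diffop r : mulop r \in diffop_pred.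
Proof. exact: mulop_diffops. Qed.

End DiffopsSubring.
Arguments diffop_pred {K} R.

(** * Extension of operators to [R_f], and integer powers of [f] *)

Section Extension.
Context (K : fieldType) (R : comAlgType K) (f : R) (reg_f : GRing.lreg f).
Implicit Types (d e : endo R) (n : int).
Local Notation loc := (loc reg_f).
Local Notation lfrac := (lfrac reg_f).
Local Notation loc_ext := (loc_ext reg_f).
Local Notation loc_exp := (loc_exp reg_f).

Lemma loc_ext_diffop d : d \in diffop_pred R -> loc_ext d \in diffop_pred loc.
Proof. by move=> /set_mem Dd; apply/mem_set; have [] := loc_extP reg_f Dd. Qed.

Lemma loc_ext_lfrac d a : d \in diffop_pred R ->
  loc_ext d (lfrac a 0) = lfrac (d a) 0.
Proof. by move=> /set_mem Dd; have [_] := loc_extP reg_f Dd; apply. Qed.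

Lemma loc_ext_eq d (e : endo loc) : d \in diffop_pred R ->
  e \in diffop_pred loc -> (forall a, e (lfrac a 0) = lfrac (d a) 0) ->
  loc_ext d = e.
Proof. by move=> /set_mem Dd /set_mem De; apply: loc_ext_uniq. Qed.

Lemma loc_extD d e : d \in diffop_pred R -> e \in diffop_pred R ->
  loc_ext (d + e) = loc_ext d + loc_ext e.
Proof.
move=> Dd De; apply: loc_ext_eq; rewrite ?rpredD ?loc_ext_diffop // => a.
by rewrite !endoDE !loc_ext_lfrac // lfrac0D.
Qed.

Lemma loc_ext0 : loc_ext 0 = 0.
Proof. by apply: loc_ext_eq; rewrite ?rpred0 // => a; rewrite !endo0E. Qed.

Lemma loc_ext_sum (I : eqType) (r : seq I) (F : I -> endo R) :
  (forall i, i \in r -> F i \in diffop_pred R) ->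
  loc_ext (\sum_(i <- r) F i) = \sum_(i <- r) loc_ext (F i).
Proof.
elim: r => [|i r IHr] DF; first by rewrite !big_nil loc_ext0.
have DFr j : j \in r -> F j \in diffop_pred R.
  by move=> jr; rewrite DF ?in_cons ?jr ?orbT.
rewrite !big_cons loc_extD ?IHr // ?DF ?mem_head //.
by rewrite big_seq rpred_sum.
Qed.

Lemma endo_intE (S : comAlgType K) n (x : S) : (n%:~R : endo S) x = x *~ n.
Proof.
have natE (m : nat) : (m%:R : endo S) x = x *+ m.
  by elim: m => [|m IHm]; rewrite ?mulr0n // !mulrS endoDE endo1E IHm.
by case: n => m; rewrite ?NegzE ?mulrNz ?endoNE -!pmulrn natE.
Qed.

Lemma lfrac_mulrz a n : lfrac (a *~ n) 0 = lfrac a 0 *~ n.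
Proof.
have nat_lfrac (m : nat) : lfrac (a *+ m) 0 = lfrac a 0 *+ m.
  by elim: m => [|m IHm]; rewrite ?mulr0n // !mulrS lfrac0D IHm.
case: n => m; rewrite ?NegzE ?mulrNz -!pmulrn ?nat_lfrac //.
by rewrite -nat_lfrac lfracN.
Qed.

Lemma loc_extMz d n : d \in diffop_pred R ->
  loc_ext (d * n%:~R) = loc_ext d * n%:~R.
Proof.
move=> Dd; apply: loc_ext_eq; rewrite ?rpredM ?rpred_int ?loc_ext_diffop //.
by move=> a; rewrite !endoME !endo_intE -lfrac_mulrz loc_ext_lfrac.
Qed.

(** Isolates the dependence on [n]: the operators on [R_f] are fixed, and [n] enters only through
    the integer factors [n ^ i]. *)
Lemma loc_ext_horner (p : {poly endo R}) n : p \is a polyOver (diffop_pred R) ->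
  loc_ext p.[n%:~R] = \sum_(i < size p) loc_ext p`_i * (n ^+ i)%:~R.
Proof.
move=> /polyOverP Dp; rewrite horner_coef loc_ext_sum => [|i _].
  by apply: eq_bigr => i _; rewrite -rmorphXn loc_extMz.
by rewrite rpredM ?rpredX ?rpred_int.
Qed.

Lemma loc_expS n : loc_exp (n + 1) = lfrac f 0 * loc_exp n.
Proof.
case: n => [n|[|n]].
- by rewrite -PoszD addn1 /= lfracM -exprS.
- by rewrite NegzE addNr; have := lfracK reg_f 1; rewrite expr1 => ->.
- have -> : Negz n.+1 + 1 = Negz n.
    by rewrite !NegzE -(addn1 n.+1) PoszD opprD subrK.
  rewrite /= lfracM.
  by apply/eqP; rewrite eq_lfrac !mulr1 add0n -exprSr.
Qed.

Lemma loc_expNK n : loc_exp (- n) * loc_exp n = 1.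
Proof.
case: n => [[|n]|n].
- by rewrite oppr0 /= expr0 lfrac1 mul1r.
- by rewrite -NegzE /= mulrC lfracK.
- by rewrite NegzE opprK -NegzE /= lfracK.
Qed.

End Extension.

(** * Polynomial functions on the integers, via finite differences *)

Section FiniteDifferences.
Context (V : zmodType).
Implicit Types (u v : int -> V).

(** Polynomial functions of degree below [m], encoded by a vanishing [m]-th forward difference,
    which makes sense in any abelian group. *)
Fixpoint fdiff_nilp m u : Prop :=
  if m is m'.+1 then fdiff_nilp m' (fun n => u (n + 1) - u n)
  else forall n, u n = 0.

Lemma eq_fdiff_nilp m u v : u =1 v -> fdiff_nilp m u -> fdiff_nilp m v.
Proof. by move=> /funext ->. Qed.

Lemma fdiff_nilp_shift m u :
  fdiff_nilp m u -> fdiff_nilp m (fun n => u (n + 1)).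
Proof.
elim: m u => [|m IHm] u //= mu.
exact: (IHm (fun n => u (n + 1) - u n)).
Qed.

Lemma fdiff_nilpB m u v : fdiff_nilp m u -> fdiff_nilp m v ->
  fdiff_nilp m (fun n => u n - v n).
Proof.
elim: m u v => [|m IHm] u v /=; first by move=> u0 v0 n; rewrite u0 v0 subrr.
move=> mu mv; apply: eq_fdiff_nilp (IHm _ _ mu mv) => n.
by rewrite !opprD addrACA.
Qed.

Lemma fdiff_nilp0 m : fdiff_nilp m (fun _ => 0).
Proof.
by elim: m => [//|m IHm] /=; apply: eq_fdiff_nilp IHm => n; rewrite subrr.
Qed.

Lemma fdiff_nilpN m u : fdiff_nilp m u -> fdiff_nilp m (fun n => - u n).
Proof.
move=> /(fdiff_nilpB (fdiff_nilp0 m)); apply: eq_fdiff_nilp => n.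
exact: sub0r.
Qed.

Lemma fdiff_nilpD m u v : fdiff_nilp m u -> fdiff_nilp m v ->
  fdiff_nilp m (fun n => u n + v n).
Proof.
move=> mu /fdiff_nilpN /(fdiff_nilpB mu); apply: eq_fdiff_nilp => n.
by rewrite opprK.
Qed.

Lemma fdiff_nilpS m u : fdiff_nilp m u -> fdiff_nilp m.+1 u.
Proof.
elim: m u => [|m IHm] u /= mu; first by move=> n; rewrite !mu subrr.
exact: (IHm (fun n => u (n + 1) - u n)).
Qed.

(** The difference of [n * u(n)] is [n * (u(n + 1) - u(n)) + u(n + 1)]: induction handles the first
    term, the shift lemma the second. *)
Lemma fdiff_nilpMz m u : fdiff_nilp m u -> fdiff_nilp m.+1 (fun n => u n *~ n).
Proof.
elim: m u => [|m IHm] u mu; first by move=> n /=; rewrite !mu !mul0rz subrr.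
have Dmu : fdiff_nilp m (fun n => u (n + 1) - u n) by [].
apply: eq_fdiff_nilp (fdiff_nilpD (IHm _ Dmu) (fdiff_nilp_shift mu)) => n.
by rewrite mulrzDr mulr1z mulrzBl addrAC.
Qed.

(** The difference of [u] also vanishes on the naturals, hence everywhere by induction; so [u] is
    constant, equal to [u 0]. *)
Lemma fdiff_nilp_vanish m u : fdiff_nilp m u ->
  (forall n : nat, u n = 0) -> forall n, u n = 0.
Proof.
elim: m u => [|m IHm] u //= mu u0.
have Du0 n : u (n + 1) = u n.
  by apply/eqP; rewrite -subr_eq0; apply/eqP/(IHm _ mu) => k;
     rewrite -PoszD !u0 subrr.
elim/int_ind => [|n _|n IHn]; try exact: u0.
by rewrite -(Du0 (- n.+1%:Z)) -addn1 PoszD opprD subrK.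
Qed.

Definition fdiff_poly u := exists m, fdiff_nilp m u.

Lemma fdiff_nilp_leq m m' u : (m <= m')%N -> fdiff_nilp m u -> fdiff_nilp m' u.
Proof.
by move=> /subnK <- mu; elim: (m' - m)%N => // k IHk; apply: fdiff_nilpS.
Qed.

Lemma fdiff_polyD u v : fdiff_poly u -> fdiff_poly v ->
  fdiff_poly (fun n => u n + v n).
Proof.
move=> [m mu] [m' mv]; exists (maxn m m'); apply: fdiff_nilpD.
  exact: fdiff_nilp_leq (leq_maxl _ _) mu.
exact: fdiff_nilp_leq (leq_maxr _ _) mv.
Qed.

Lemma fdiff_polyN u : fdiff_poly u -> fdiff_poly (fun n => - u n).
Proof. by move=> [m /fdiff_nilpN]; exists m. Qed.

Lemma fdiff_polyMX u i : fdiff_poly u -> fdiff_poly (fun n => u n *~ n ^+ i).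
Proof.
move=> [m mu]; exists (m + i)%N; elim: i => [|i IHi].
  by rewrite addn0; apply: eq_fdiff_nilp mu.
rewrite addnS; apply: eq_fdiff_nilp (fdiff_nilpMz IHi) => n.
by rewrite exprSr mulrzA.
Qed.

Lemma fdiff_poly_cst (x : V) : fdiff_poly (fun=> x).
Proof. by exists 1%N => n; rewrite subrr. Qed.

Lemma fdiff_poly_sum N (U : 'I_N -> int -> V) :
  (forall i, fdiff_poly (U i)) -> fdiff_poly (fun n => \sum_(i < N) U i n).
Proof.
elim: N U => [|N IHN] U pU.
  by exists 0%N => n; rewrite big_ord0.
have := fdiff_polyD (IHN _ (fun i => pU (widen_ord (leqnSn N) i))) (pU ord_max).
by case=> m mu; exists m; apply: eq_fdiff_nilp mu => n; rewrite big_ord_recr.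
Qed.

End FiniteDifferences.

(** * From sandwich equations to functional equations *)

Section Inclusions.
Context (K : fieldType) (R : comAlgType K) (f : R) (reg_f : GRing.lreg f).
Implicit Types (d e : endo R) (n : int) (b : {poly K}).
Local Notation loc := (loc reg_f).
Local Notation lfrac := (lfrac reg_f).
Local Notation loc_ext := (loc_ext reg_f).
Local Notation loc_exp := (loc_exp reg_f).

(** The difference of [f^-n e(f^n)] is the same expression for [e' = f^-1 [e, f]], of order one
    less; at order 0 the expression is constant. *)
Lemma fdiff_poly_conj k (e : endo loc) : diffops_le loc k e ->
  fdiff_poly (fun n => loc_exp (- n) * e (loc_exp n)).
Proof.
suff H : diffops_le loc k e ->
    fdiff_nilp k.+1 (fun n => loc_exp (- n) * e (loc_exp n)).
  by move=> /H; exists k.+1.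
elim: k e => [|k IHk] e; first by move=> [c _ <-] n;
  rewrite !mulopE !(mulrCA _ c) !loc_expNK subrr.
move=> De; pose e' := mulop (lfrac 1 1) *
  (e * mulop (lfrac f 0) - mulop (lfrac f 0) * e).
have De' : diffops_le loc k e' by apply: diffops_le_mulopl; apply: De.
apply: eq_fdiff_nilp (IHk _ De') => n.
have ff : lfrac 1 1 * lfrac f 0 = 1 by rewrite mulrC (lfracK reg_f 1).
have eN : loc_exp (- n) = lfrac f 0 * loc_exp (- (n + 1)).
  by rewrite -loc_expS opprD subrK.
rewrite endoME !mulopE endoDE endoNE !endoME !mulopE -loc_expS.
rewrite !mulrBr; congr (_ - _).
  rewrite eN -[in RHS](mul1r (loc_exp (- (n + 1)))) -ff; ring.
by rewrite [lfrac 1 1 * _]mulrA ff mul1r.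
Qed.

(** After division by [f^n], invertible in [R_f], the defect [u] of the equation is a polynomial
    function of [n] that vanishes on the naturals. *)
Lemma BS_equation_nat (p : {poly endo R}) b :
  p \is a polyOver (diffop_pred R) ->
  (forall n : nat, p.[n%:R] (f ^+ n.+1) = b.[n%:R] *: f ^+ n) ->
  BS_equation reg_f p b.
Proof.
move=> Dp pb.
pose u n := loc_exp (- n) * loc_ext p.[n%:~R] (loc_exp (n + 1)) - b.[n%:~R]%:A.
have [m mu] : fdiff_poly u.
  apply: fdiff_polyD; last apply: fdiff_polyN.
    (* One factor [f] of [f^(n+1)] is absorbed into the operator, so that each coefficient of [p]
       contributes a conjugate by [f^n]. *)
    have [//|m mu] := @fdiff_poly_sum loc (size p) (fun i n =>
      loc_exp (- n) * (loc_ext p`_i * mulop (lfrac f 0)) (loc_exp n)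
        *~ n ^+ i) _.
      move=> i; apply: fdiff_polyMX.
      have /diffopsP[k Dk] :
          loc_ext p`_i * mulop (lfrac f 0) \in diffop_pred loc.
        by rewrite rpredM ?mulop_diffop ?loc_ext_diffop //; apply/polyOverP.
      exact: fdiff_poly_conj Dk.
    exists m; apply: eq_fdiff_nilp mu => n.
    rewrite loc_ext_horner // loc_expS.
    elim/big_rec2: _ => [|i x y _ IH]; first by rewrite endo0E mulr0.
    rewrite endoDE mulrDr -IH !endoME endo_intE mulopE.
    by rewrite raddfMz mulrzAr.
  have [|m mu] := @fdiff_poly_sum loc (size b) (fun i n => (b`_i)%:A *~ n ^+ i).
    by move=> i; apply/fdiff_polyMX/fdiff_poly_cst.
  exists m; apply: eq_fdiff_nilp mu => n.
  rewrite horner_coef scaler_suml; apply: eq_bigr => i _.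
  by rewrite -rmorphXn /= mulrzr scalerMzl.
move=> n; have : u n = 0.
  apply: (fdiff_nilp_vanish mu) => {}n.
  rewrite /u -PoszD addn1 /= loc_ext_lfrac; last first.
    by rewrite rpred_horner // rpred_nat.
  rewrite pb -lfracZ -scalerAr -[lfrac (f ^+ n) 0]/(loc_exp n) loc_expNK.
  by rewrite subrr.
move=> /eqP; rewrite subr_eq0 => /eqP /(congr1 (fun x => loc_exp n * x)).
by rewrite mulrA [loc_exp n * _]mulrC loc_expNK mul1r -scalerAr mulr1.
Qed.

Lemma SBS_ideal_sub : SBS_ideal f `<=` BS_ideal reg_f.
Proof.
move=> b [ops Dops eq_b].
(* [q ab] evaluates at [n] to multiplication by [beta(n)(1)]. This commutes with multiplication by
   [f^(n+1)], so [ab.1 * q ab] sends [f^(n+1)] to the value at 1 of the sandwiched term. *)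
pose q (ab : {poly endo R} * {poly endo R}) : {poly endo R} :=
  \poly_(i < size ab.2) mulop (ab.2`_i 1).
have qE ab (n : nat) : (q ab).[n%:R] = mulop (ab.2.[n%:R] 1).
  rewrite horner_poly horner_coef; apply: endoP => x; rewrite mulopE.
  elim/big_rec2: _ => [|i d e _ IH]; first by rewrite !endo0E mul0r.
  rewrite !endoDE mulrDl -IH; congr (_ + _).
  rewrite !endoME -!natrX pmulrn !endo_intE mulopE.
  by rewrite mulrzAr raddfMz mulrzAl.
pose p := \sum_(ab <- ops) ab.1 * q ab.
have Dp : p \is a polyOver (diffop_pred R).
  rewrite /p big_seq rpred_sum // => ab /Dops[D1 D2].
  rewrite rpredM //; apply/polyOverP => i; rewrite coef_poly.
  by case: ifP; rewrite ?mulop_diffop ?rpred0.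
exists p; first exact: Dp.
apply: BS_equation_nat Dp _ => n.
have /(congr1 (fun d : endo R => d 1)) := eq_b n.
rewrite mulopE mulr1 => <-; rewrite horner_sum.
elim/big_rec2: _ => // ab d e _ IH; rewrite !endoDE IH; congr (_ + _).
rewrite hornerM_comm; last exact/commr_sym/commr_nat.
by rewrite qE !endoME !mulopE mulrC.
Qed.

(** * From functional equations to sandwich equations *)

Definition sandwiched : set (endo R) :=
  [set d | exists2 r : seq (endo R * endo R),
     forall ab, ab \in r -> ab.1 \in diffop_pred R /\ ab.2 \in diffop_pred R
     & forall g, mulop (d g) = \sum_(ab <- r) ab.1 * mulop g * ab.2].

Lemma sandwiched_subring : GRing.subring_closed [in sandwiched].
Proof.
split.
- apply/mem_set; exists [:: (1, 1)] => [ab|g].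
    by rewrite mem_seq1 => /eqP -> /=; rewrite rpred1.
  by rewrite big_seq1 mul1r mulr1.
- move=> d e /set_mem[r Dr dE] /set_mem[s Ds eE]; apply/mem_set.
  exists (r ++ [seq (- ab.1, ab.2) | ab <- s]) => [ab|g].
    rewrite mem_cat => /orP[/Dr //|/mapP[cd /Ds[Dc Dd] ->]] /=.
    by rewrite rpredN.
  rewrite big_cat big_map /=.
  under [X in _ = _ + X]eq_bigr do rewrite !mulNr.
  rewrite sumrN -dE -eE; apply: endoP => x.
  by rewrite mulopE mulrBl.
- move=> d e /set_mem[r Dr dE] /set_mem[s Ds eE]; apply/mem_set.
  (* The expression for [e g] is nested inside the one for [d], so the right factors compose in
     reverse order. *)
  exists [seq (ab.1 * cd.1, cd.2 * ab.2) | ab <- r, cd <- s] => [ab|g].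
    move=> /allpairsP[[[a1 a2] [c1 c2]] /= [/Dr[/= D1 D2] /Ds[/= D3 D4] ->]] /=.
    by rewrite !rpredM.
  rewrite big_allpairs_dep /= -[mulop _]/(mulop (d (e g))) dE.
  apply: eq_bigr => ab _.
  rewrite eE mulr_sumr mulr_suml; apply: eq_bigr => cd _.
  by rewrite /= !mulrA.
Qed.

(* Here [d = mulop (d 1) + t] with [t] a derivation, so that
   [mulop (t g) = t * mulop g - mulop g * t]. *)
Lemma diffops1_sandwiched : diffops_le R 1 `<=` sandwiched.
Proof.
move=> d Dd.
have dM g x : d (g * x) = g * d x + d g * x - g * d 1 * x.
  have [c _ cE] := Dd g.
  have cx y : c * y = d (g * y) - g * d y.
    by have := congr1 (fun h : endo R => h y) cE;
       rewrite mulopE endoDE endoNE !endoME !mulopE.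
  have : d (g * x) = g * d x + c * x by rewrite cx addrC subrK.
  move=> ->; have := cx 1; rewrite !mulr1 => ->.
  by rewrite mulrBl addrA.
have D1 : d \in diffop_pred R by apply/diffopsP; exists 1%N.
have I1 : (1 : endo R) \in diffop_pred R by rewrite rpred1.
have IN1 : (- 1 : endo R) \in diffop_pred R by rewrite rpredN1.
(* The first two pairs use [d] in place of [t]: the commutator with [mulop g] is the same, since
   multiplications commute. The third restores [mulop (d 1 * g)]. *)
exists [:: (d, 1); (- 1, d); (mulop (d 1), 1)] => [ab|g].
  rewrite !in_cons in_nil orbF => /or3P[] /eqP -> //=.
  by rewrite mulop_diffop.
rewrite !big_cons big_nil addr0 /= !mulr1 !mulNr mul1r; apply: endoP => x.
by rewrite !endoDE endoNE !endoME !mulopE dM; ring.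
Qed.

Context (gen_D1 : generated_as_ring_by (diffops R) (diffops_le R 1)).

Lemma diffops_sandwiched : diffops R `<=` sandwiched.
Proof.
rewrite [diffops R]gen_D1; apply: smallest_sub.
  exact: sandwiched_subring.
exact: diffops1_sandwiched.
Qed.

Lemma BS_ideal_sub : BS_ideal reg_f `<=` SBS_ideal f.
Proof.
move=> b [p pD eq_b]; have Dp : p \is a polyOver (diffop_pred R) by exact: pD.
have Di i : p`_i \in diffop_pred R by apply: polyOverP.
have /choice[r rP] (i : nat) : exists r : seq (endo R * endo R),
    (forall ab, ab \in r -> ab.1 \in diffop_pred R /\ ab.2 \in diffop_pred R)
    /\ forall g, mulop (p`_i g) = \sum_(ab <- r) ab.1 * mulop g * ab.2.
  by have [r] := diffops_sandwiched (set_mem (Di i)); exists r.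
(* The power [s^i] is carried by the left factor; the right factor is constant in [s]. *)
pose term i (ab : endo R * endo R) : {poly endo R} * {poly endo R} :=
  (ab.1 *: 'X^i, (ab.2)%:P).
pose ops := flatten [seq map (term i) (r i) | i <- index_iota 0 (size p)].
exists ops => [ab|n].
  move=> /flatten_mapP[i _ /mapP[cd /(proj1 (rP i))[Dc Dd] ->]] /=.
  suff H : (cd.1 *: 'X^i \is a polyOver (diffop_pred R)) /\
    (cd.2%:P \is a polyOver (diffop_pred R)) by exact: H.
  rewrite polyOverC; split=> //.
  by apply: polyOverZ; rewrite ?rpredX ?polyOverX.
transitivity (mulop (p.[n%:R] (f ^+ n.+1))); last first.
  congr mulop; have := eq_b n.
  rewrite -PoszD addn1 /= loc_ext_lfrac; last first.
    by rewrite rpred_horner // rpred_nat.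
  by rewrite lfracZ => /eqP; rewrite eq_lfrac !expr0 !mul1r => /eqP ->.
rewrite /ops big_flatten big_map /= horner_coef big_mkord.
elim/big_rec2: _ => [|i d e _ ->].
  by apply: endoP => x; rewrite mulopE endo0E mul0r.
rewrite big_map endoDE.
have -> x y : mulop (x + y) = mulop x + mulop y :> endo R.
  by apply: endoP => z; rewrite endoDE !mulopE mulrDl.
congr (_ + _); rewrite endoME -natrX.
set N : endo R := (n ^ i)%:R; set g := f ^+ n.+1.
have NE y : N y = y *~ (n ^ i)%N by rewrite /N pmulrn endo_intE.
(* The pairs in [r i] serve every argument, so the identity may be applied to [N g], which already
   contains the factor [n ^ i]. *)
have -> : mulop (p`_i (N g)) =
    \sum_(ab <- r i) ab.1 * mulop (N g) * ab.2.
  exact: (proj2 (rP i)).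
apply: eq_bigr => ab _ /=; rewrite hornerZ hornerXn hornerC -natrX.
rewrite -[ab.1 * _ * mulop g]mulrA.
do 2!congr (_ * _); apply: endoP => x.
by rewrite -/N mulopE endoME mulopE !NE mulrzAl.
Qed.

Lemma BS_eq_SBS : BS reg_f = SBS f.
Proof.
congr monic_generator; apply/seteqP; split; [exact: BS_ideal_sub|].
exact: SBS_ideal_sub.
Qed.

End Inclusions.

From mathcomp Require Import mpoly.

(** * Polynomial rings: operators of order at most 1 generate *)

Section PolynomialRing.
Context (K : fieldType) (char0 : [pchar K] =i pred0) (n : nat).
Local Notation R := {mpoly K[n]}.
Implicit Types (d e : endo R) (m : 'X_{1..n}) (i : 'I_n).

Lemma mdeg_eqS m N : mdeg m = N.+1 ->
  exists i m', m = (U_(i) + m')%MM /\ mdeg m' = N.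
Proof.
move=> mN; have /existsP[i mi] : [exists i, m i != 0%N].
  apply: contraT => /existsPn m0; suff : mdeg m == 0%N by rewrite mN.
  by rewrite mdegE big1 // => i _; have := m0 i; rewrite negbK => /eqP.
have Ui : (U_(i) <= m)%MM.
  by apply/mnm_lepP => j; rewrite mnm1E; case: eqP => // <-; rewrite lt0n.
exists i, (m - U_(i))%MM; split; first by rewrite addmC submK.
by apply/eqP; rewrite -eqSS -mN -addn1 -(mdeg1 i) -mdegD submK.
Qed.

Lemma mpoly_endo_eq0 d : (forall m, d 'X_[m] = 0) -> d = 0.
Proof.
move=> d0; apply: endoP => p; rewrite (mpolyE p) linear_sum big1 // => m _.
by rewrite linearZ /= d0 scaler0.
Qed.

(** By induction on the order each [[d, x_i]] is 0, as it kills the monomials of degree one less. So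
    [d] commutes with the variables, and vanishing passes from ['X_[m']] to [x_i * 'X_[m']]. *)
Lemma diffops_le_eq0 k d : diffops_le R k d ->
  (forall m, (mdeg m <= k)%N -> d 'X_[m] = 0) -> d = 0.
Proof.
elim: k d => [|k IHk] d.
  move=> [c _ <-] /(_ 0%MM); rewrite mdeg0 mulopE mpolyX0 mulr1 => -> //.
  by apply: endoP => x; rewrite mulopE mul0r.
move=> Dd d0; apply: mpoly_endo_eq0 => m; move eqN: (mdeg m) => N.
elim: N m eqN => [|N IHN] m; first by move=> m0; rewrite d0 // m0.
move=> /mdeg_eqS[i [m' [-> m'N]]].
have /(congr1 (fun h : endo R => h 'X_[m'])) :
    d * mulop 'X_i - mulop 'X_i * d = 0.
  apply: IHk; first exact: Dd.
  move=> q qk; rewrite endoDE endoNE !endoME !mulopE -mpolyXD.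
  by rewrite (d0 q (leqW qk)) d0 ?mulr0 ?subrr // mdegD mdeg1.
rewrite endoDE endoNE !endoME !mulopE -mpolyXD (IHN m' m'N) mulr0 subr0.
by rewrite endo0E.
Qed.

Definition mderivm_op m : endo R := endo_of (mderivm_is_linear (R := K) m).

(** Factoring [mderivm_op m] into [mdeg m] first-order partials serves twice: to bound its order,
    and to place it in a subring. *)
Lemma mderivm_op_ind (P : nat -> endo R -> Prop) :
  P 0%N 1 -> (forall i, P 1%N (mderivm_op U_(i))) ->
  (forall k l d e, P k d -> P l e -> P (k + l)%N (d * e)) ->
  forall m, P (mdeg m) (mderivm_op m).
Proof.
move=> P0 P1 PM m; move eqN: (mdeg m) => N.
elim: N m eqN => [|N IHN] m.
  move=> /eqP; rewrite mdeg_eq0 => /eqP ->.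
  suff -> : mderivm_op 0%MM = 1 by [].
  by apply: endoP => p; apply: mderivm0m.
move=> /mdeg_eqS[i [m' [-> m'N]]].
have -> : mderivm_op (U_(i) + m')%MM = mderivm_op U_(i) * mderivm_op m'.
  by apply: endoP => p; rewrite endoME addmC; apply: mderivmDm.
by rewrite -add1n; apply: PM => //; apply: IHN.
Qed.

Lemma mderivm_op1 i : diffops_le R 1 (mderivm_op U_(i)).
Proof.
move=> r; exists (mderiv i r) => //; apply: endoP => x.
rewrite endoDE endoNE !endoME !mulopE /= !mderivmU1m mderivM.
by rewrite addrK.
Qed.

Lemma mderivm_op_diffops m : diffops_le R (mdeg m) (mderivm_op m).
Proof.
apply: mderivm_op_ind m.
- by rewrite -mulop1; exists 1.
- exact: mderivm_op1.
- by move=> k l d e; apply: diffops_leM.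
Qed.

Definition mfact m := (\prod_(i < n) (m i)`!)%N.

Lemma mfact_neq0 m : (mfact m)%:R != 0 :> K.
Proof.
rewrite ((pcharf0P K).1 char0) -lt0n prodn_gt0 // => i.
exact: fact_gt0.
Qed.

(** If [q] differs from [m] and has no larger degree, some exponent of [q] is below that of [m], and
    its falling factorial vanishes. *)
Lemma mderivm_op_small m q : (mdeg q <= mdeg m)%N ->
  mderivm_op m 'X_[q] = if q == m then (mfact m)%:R else 0.
Proof.
move=> qm; rewrite /= mderivmX; case: eqP => [->|neq].
  have -> : (m - m)%MM = 0%MM by apply/mnmP => i; rewrite mnmBE subnn mnm0E.
  rewrite mpolyX0 scaler_nat; congr (_%:R).
  by apply: eq_bigr => i _; rewrite ffactnn.
have /existsP[i qmi] : [exists i, q i < m i]%N.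
  apply: contra_notT neq => /existsPn mq.
  have mleq : (m <= q)%MM by apply/mnm_lepP => i; rewrite leqNgt.
  have := qm; rewrite -{1}(submK mleq) mdegD -{2}[mdeg m]add0n leq_add2r leqn0.
  by rewrite mdeg_eq0 => /eqP qm0; rewrite -(submK mleq) qm0 add0m.
by rewrite (bigD1 i) //= ffact_small // mul0n scale0r.
Qed.

Section Generation.
Context (A : set (endo R)) (A_subring : GRing.subring_closed (mem A))
        (A1 : diffops_le R 1 `<=` A).

(** Built degree by degree: the correction in degree [j] leaves lower degrees alone, and [j <= k] at
    each step keeps the order at most [k]. *)
Lemma diffops_approx k d j : diffops_le R k d -> (j <= k.+1)%N ->
  exists e, [/\ diffops_le R k e, e \in A &
    forall m, (mdeg m < j)%N -> d 'X_[m] = e 'X_[m]].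
Proof.
have [A_1 A_B A_M] := A_subring.
have A_0 : 0 \in A by rewrite -(subrr 1) A_B.
have A_D x y : x \in A -> y \in A -> x + y \in A.
  by move=> Ax Ay; rewrite -[y]opprK -[- y]sub0r !A_B.
have A_mulop r : mulop r \in A.
  by apply/mem_set/A1/(@diffops_leS _ _ 0) => //; exists r.
have A_mderivm m : mderivm_op m \in A.
  apply: (@mderivm_op_ind (fun _ d => d \in A)) => // i.
  exact/mem_set/A1/mderivm_op1.
move=> Dd; elim: j => [|j IHj] jk.
  exists 0; split=> //.
  by rewrite -(subrr d); apply: diffops_leB.
have [e [De Ae eE]] := IHj (ltnW jk).
(* Among monomials of degree at most [j], where [mdeg m = j], [t m] is nonzero at most on ['X_[m]],
   where dividing by [m!] makes it equal to the error [d - e]. *)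
pose t m := mulop ((mfact m)%:R^-1 *: (d - e) 'X_[m]) * mderivm_op m.
pose s := \sum_(m : 'X_{1..n < j.+1} | mdeg m == j) t m.
exists (e + s); split.
- apply: diffops_leD => //; rewrite /s.
  apply: (big_ind (diffops_le R k)) => [|x y|m mj].
  + by rewrite -(subrr d); apply: diffops_leB.
  + exact: diffops_leD.
  + by apply: diffops_le_mulopl; apply: diffops_leS (mderivm_op_diffops m);
      rewrite (eqP mj).
- apply: (A_D) => //; rewrite /s.
  apply: (big_ind (fun x => x \in A)) => [//|x y|m _]; first exact: A_D.
  exact: (A_M _ _ (A_mulop _) (A_mderivm _)).
move=> q; rewrite ltnS => qj; rewrite endoDE.
have tE m : mdeg m == j -> t m 'X_[q] = if q == m then (d - e) 'X_[q] else 0.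
  move=> /eqP mj; rewrite endoME mulopE mderivm_op_small ?mj //.
  case: eqP => [->|_]; last by rewrite mulr0.
  by rewrite mulr_natr -scaler_nat scalerA divff ?scale1r // mfact_neq0.
have -> : s 'X_[q] = (d - e) 'X_[q].
  transitivity (\sum_(m : 'X_{1..n < j.+1} | mdeg m == j) t m 'X_[q]).
    by rewrite /s; elim/big_rec2: _ => [|m x y _ <-]; rewrite ?endo0E.
  have [qj'|] := ltnP (mdeg q) j.
    rewrite endoDE endoNE eE // subrr big1 // => m mj; rewrite tE //.
    by case: eqP => // qm; rewrite qm (eqP mj) ltnn in qj'.
  move=> jq; have qjE : mdeg q == j by rewrite eqn_leq qj.
  have qb : (mdeg q < j.+1)%N by [].
  rewrite (bigD1 (BMultinom qb)) // tE // eqxx.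
  rewrite big1 => [|m /andP[mj neq]]; first exact: addr0.
  rewrite tE //; case: eqP => // qm.
  by case/eqP: neq; apply: val_inj.
by rewrite endoDE endoNE addrC subrK.
Qed.

Lemma mpoly_diffops_sub : diffops R `<=` A.
Proof.
(* Here [j = k.+1], so [e] agrees with [d] on all monomials of degree at most [k]. *)
move=> d [k _ Dd]; have [e [De Ae eE]] := diffops_approx Dd (leqnn _).
suff -> : d = e by apply: set_mem.
apply/eqP; rewrite -subr_eq0; apply/eqP/(@diffops_le_eq0 k).
  exact: diffops_leB.
by move=> m mk; rewrite endoDE endoNE eE // subrr.
Qed.

End Generation.

Lemma mpoly_diffops_generated :
  generated_as_ring_by (diffops R) (diffops_le R 1).
Proof.
apply/seteqP; split=> [d Dd A [A_subring A1]|].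
  exact: (mpoly_diffops_sub A_subring A1).
apply: smallest_sub; first exact: diffops_subring_closed.
by move=> d Dd; exists 1%N.
Qed.

End PolynomialRing.

Theorem proposition6p3 (K : fieldType) (char0 : [pchar K] =i pred0) :
  (forall R : comAlgType K,
     generated_as_ring_by (diffops R) (diffops_le R 1) ->
     forall (f : R) (reg_f : GRing.lreg f), BS reg_f = SBS f) /\
  (forall (n : nat) (f : {mpoly K[n]}) (f_neq0 : f != 0),
     BS (mulfI f_neq0) = SBS f).
Proof.
split=> [R gen f reg_f|n f f_neq0]; first exact: BS_eq_SBS.
exact/BS_eq_SBS/mpoly_diffops_generated.
Qed.
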